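(* Let $\alpha\in[1,2]$, $\kappa_1,\kappa_2\in\mathbb{R}$, $\gamma>0$, $f(u)=\kappa_1 u+\tfrac32\gamma u^2$, $N\in\mathbb{N}$, and let $u_0\in L^2_{\mathrm{per}}(I)$ be real-valued. Let $u_N$ be a solution, on a time interval $[0,\tau)$, of the semi-discrete Fourier spectral Galerkin scheme: $u_N(\cdot,t)\in V_N$, $u_N(\cdot,0)=P_Nu_0$, and for all $\phi\in V_N$ and all $t\in[0,\tau)$ $$\bigl((u_N)_t,\phi\bigr)+\bigl((u_N)_t,\mathcal{D}^\alpha\phi\bigr)=\bigl(f(u_N),\phi_x\bigr)-\kappa_2\Bigl[2\bigl(u_N(u_N)_x,\mathcal{D}^\alpha\phi\bigr)+\bigl(u_N\mathcal{D}^\alpha(u_N)_x,\phi\bigr)\Bigr].$$ Then for all $t\in[0,\tau)$ $$\frac{d}{dt}\int_I u_N\,dx=0\qquad\text{and}\qquad \frac{d}{dt}\int_I\Bigl(u_N^2+|\mathcal{D}^{\alpha/2}u_N|^2\Bigr)\,dx=0.$$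
   Context: $I=[-\pi,\pi]$; functions are $2\pi$-periodic in $x$. $L^2_{\mathrm{per}}(I)$ is the space of square-integrable periodic functions with inner product $(u,v)=\int_{-\pi}^{\pi}u\overline{v}\,dx$. Fourier coefficients: $\hat u(k)=\frac1{2\pi}\int_I u(x)e^{-ikx}\,dx$, $k\in\mathbb{Z}$. For $\beta\ge 0$, the fractional Laplacian $\mathcal{D}^\beta=(-\Delta)^{\beta/2}$ is the Fourier multiplier $\widehat{\mathcal{D}^\beta u}(k)=|k|^\beta\hat u(k)$. $V_N=\operatorname{span}\{e^{ikx}:-N\le k\le N\}$ (complex span), and $P_N$ is the $L^2$-orthogonal projection onto $V_N$, $P_N\xi=\sum_{|k|\le N}\hat\xi(k)e^{ikx}$. A solution of the scheme on $[0,\tau)$ means that $t\mapsto u_N(\cdot,t)\in V_N$ is continuously differentiable (the scheme is an ODE system for the Fourier coefficients of $u_N$). *)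

(* Defs.v *)
From HB Require Import structures.
From mathcomp Require Export all_boot all_order all_algebra.
From mathcomp Require Export all_classical all_reals all_analysis.
From mathcomp Require Export complex.

Set Implicit Arguments.
Unset Strict Implicit.
Unset Printing Implicit Defensive.

Export Order.TTheory GRing.Theory Num.Theory numFieldNormedType.Exports.

Local Open Scope classical_set_scope.
Local Open Scope ring_scope.
Local Open Scope complex_scope.

Section Periodic.
Variable R : realType.
Implicit Types (u v : R -> R[i]) (x beta : R) (k : int) (N : nat).

Definition I_per : set R := `[- pi, pi].

(* Lebesgue integral over I of a complex-valued function. *)
Definition cintegral u : R[i] :=
  (\int[lebesgue_measure]_(x in I_per) complex.Re (u x)) +i*
  (\int[lebesgue_measure]_(x in I_per) complex.Im (u x)).

Definition inner u v : R[i] := cintegral (fun x => u x * (v x)^*%C).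

(* Functions rather than almost-everywhere classes. *)
Definition L2per u : Prop :=
  [/\ measurable_fun setT (fun x => complex.Re (u x)),
      measurable_fun setT (fun x => complex.Im (u x)),
      periodic u (2 * pi) &
      lebesgue_measure.-integrable I_per
        (fun x => (complex.Re (u x) ^+ 2 + complex.Im (u x) ^+ 2)%:E)].

(* exp (i theta) *)
Definition expi (theta : R) : R[i] := cos theta +i* sin theta.

Definition emode k x : R[i] := expi (k%:~R * x).

Definition fourier u k : R[i] :=
  ((2 * pi)^-1)%:C * cintegral (fun x => u x * expi (- (k%:~R * x))).

(* The integers -N, ..., N. *)
Definition modes N : seq int := [seq (j%:Z - N%:Z)%R | j <- iota 0 N.*2.+1].

Definition VN N : set (R -> R[i]) :=
  [set u | exists c : int -> R[i],
     forall x, u x = \sum_(k <- modes N) c k * emode k x].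

Definition PN N u x : R[i] := \sum_(k <- modes N) fourier u k * emode k x.

(* The Fourier multiplier |k|^beta, as the symmetric sum of its Fourier series;
   on a trigonometric polynomial the partial sums are eventually constant. *)
Definition fracLap_sum beta u (n : nat) x : R[i] :=
  \sum_(k <- modes n) (`|k|%:~R `^ beta)%:C * fourier u k * emode k x.

Definition fracLap beta u x : R[i] :=
  lim (complex.Re (fracLap_sum beta u n x) @[n --> \oo]) +i*
  lim (complex.Im (fracLap_sum beta u n x) @[n --> \oo]).

(* Derivative of a complex-valued function of the real variable x. *)
Definition dx u x : R[i] :=
  derive1 (fun y => complex.Re (u y)) x +i*
  derive1 (fun y => complex.Im (u y)) x.

End Periodic.

Section DerivativeWithin.
Variables (R : realType) (D : set R).

(* Derivatives along D: two-sided at interior points of D, one-sided at an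
   endpoint of an interval D. *)
Definition has_derivative_within (f : R -> R) (t l : R) : Prop :=
  (f s - f t) / (s - t) @[s --> within D t^'] --> l.

Definition derive_within (f : R -> R) (t : R) : R :=
  lim ((f s - f t) / (s - t) @[s --> within D t^']).

Definition C1_within (f : R -> R) : Prop :=
  (forall t, D t -> has_derivative_within f t (derive_within f t)) /\
  {within D, continuous (derive_within f)}.

Definition has_cderivative_within (g : R -> R[i]) (t : R) (l : R[i]) : Prop :=
  has_derivative_within (fun s => complex.Re (g s)) t (complex.Re l) /\
  has_derivative_within (fun s => complex.Im (g s)) t (complex.Im l).

Definition cderive_within (g : R -> R[i]) (t : R) : R[i] :=
  derive_within (fun s => complex.Re (g s)) t +i*
  derive_within (fun s => complex.Im (g s)) t.

Definition cC1_within (g : R -> R[i]) : Prop :=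
  C1_within (fun s => complex.Re (g s)) /\
  C1_within (fun s => complex.Im (g s)).

End DerivativeWithin.

Section Scheme.
Variable R : realType.

(* [0, tau), where tau may be infinite *)
Definition time_interval (tau : \bar R) : set R :=
  [set t | 0 <= t /\ (t%:E < tau)%E].

Definition nonlinearity (kappa1 gamma : R) (z : R[i]) : R[i] :=
  kappa1%:C * z + (3 / 2 * gamma)%:C * z ^+ 2.

(* u t x is the value at time t and position x; only times in [0, tau)
   matter. *)
Record galerkin_solution (alpha kappa1 kappa2 gamma : R) (N : nat)
    (tau : \bar R) (u0 : R -> R[i]) (u : R -> R -> R[i]) : Prop :=
  GalerkinSolution {
    galerkin_VN : forall t, time_interval tau t -> VN N (u t);
    galerkin_C1 : forall k,
      cC1_within (time_interval tau) (fun t => fourier (u t) k);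
    galerkin_init : u 0 = PN N u0;
    galerkin_eq : forall phi, VN N phi -> forall t, time_interval tau t ->
      let ut := fun x => cderive_within (time_interval tau) (u ^~ x) t in
      inner ut phi + inner ut (fracLap alpha phi) =
        inner (fun x => nonlinearity kappa1 gamma (u t x)) (dx phi)
        - kappa2%:C *
          (2 * inner (fun x => u t x * dx (u t) x) (fracLap alpha phi)
           + inner (fun x => u t x * fracLap alpha (dx (u t)) x) phi)
  }.

End Scheme.

(* Main.v *)
(* In Fourier coefficients the scheme tested against an arbitrary [q] reads
   [B(c', q) + B(c', Lap q) = flux(c, q)], where the flux is made of bilinear and
   trilinear forms, mean values of products, for which integration by parts
   holds. Testing with the constant gives the conservation of mass. Testing with
   [c] itself gives zero flux: the convective term is an exact derivative, and
   [2 u u_x = (u^2)_x] makes the two dispersive terms cancel. This conserves the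
   complex quantity [B(c, c) + B(c, Lap c)], which is the energy of the statement
   only when [u] is real; reality propagates from the initial value because [u]
   and its complex conjugate solve the same locally Lipschitz ODE. *)
Require Import Defs.
From mathcomp Require Import ring lra zify.

Set Implicit Arguments.
Unset Strict Implicit.
Unset Printing Implicit Defensive.

Local Open Scope classical_set_scope.
Local Open Scope ring_scope.
Local Open Scope complex_scope.

(** * Resonant sums of Fourier coefficients *)

Section Conjugation.
Variable R : realType.
Implicit Types x y : R[i].

Lemma conjcM x y : (x * y)^*%C = x^*%C * y^*%C.
Proof. exact: rmorphM. Qed.

Lemma conjcD x y : (x + y)^*%C = x^*%C + y^*%C.
Proof. exact: rmorphD. Qed.

Lemma conjcN x : (- x)^*%C = - x^*%C.
Proof. exact: rmorphN. Qed.

Lemma conjc_int (k : int) : (k%:~R : R[i])^*%C = k%:~R.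
Proof. exact: (rmorph_int (@conjc R)). Qed.

End Conjugation.

Section ResonantSums.
Variables (R : realType) (N : nat).
Implicit Types (a b c : int -> R[i]) (beta : R) (k : int).

Lemma mem_modes k : (k \in modes N) = (`|k| <= N)%N.
Proof.
apply/mapP/idP => [[j]|kN].
  by rewrite mem_iota => jN ->; lia.
exists (absz (k + N%:Z)); last by lia.
by rewrite mem_iota; lia.
Qed.

Lemma modes_uniq : uniq (modes N).
Proof. by rewrite map_inj_uniq ?iota_uniq// => i j /addIr []. Qed.

Lemma perm_modesN : perm_eq (modes N) [seq - k | k <- modes N].
Proof.
apply: uniq_perm; rewrite ?(map_inj_uniq oppr_inj) ?modes_uniq// => k.
by rewrite -[in RHS](opprK k) (mem_map oppr_inj) !mem_modes abszN.
Qed.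

(** The index set is symmetric about 0. This is what lets conjugation, which reverses the sign of a
    frequency, act on sums over [modes N]. *)
Lemma sum_modesN (F : int -> R[i]) :
  \sum_(k <- modes N) F (- k) = \sum_(k <- modes N) F k.
Proof.
transitivity (\sum_(k <- [seq - k | k <- modes N]) F k).
  by rewrite [RHS]big_map.
exact/esym/perm_big/perm_modesN.
Qed.

(* [B2 a b] and [T3 a b c] are the mean values over a period of the product of
   the trigonometric polynomials with coefficients [a], [b] (and [c]); [cdx],
   [clap] and [cconj] are differentiation, the fractional Laplacian and complex
   conjugation on coefficients. *)
Definition B2 a b : R[i] :=
  \sum_(j <- modes N) \sum_(l <- modes N) a j * b l * (j + l == 0)%:R.

Definition T3 a b c : R[i] :=
  \sum_(j <- modes N) \sum_(l <- modes N) \sum_(m <- modes N)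
    a j * b l * c m * (j + l + m == 0)%:R.

Definition cdx a k : R[i] := 'i%C * k%:~R * a k.

Definition clap beta a k : R[i] := (`|k|%:~R `^ beta)%:C * a k.

Definition cconj a k : R[i] := (a (- k))^*%C.

Definition csub a b k : R[i] := a k - b k.

Lemma B2C a b : B2 a b = B2 b a.
Proof.
rewrite /B2 exchange_big; apply: eq_bigr => j _; apply: eq_bigr => l _.
by rewrite addrC; congr (_ * _); rewrite mulrC.
Qed.

Lemma T3C a b c : T3 a b c = T3 b a c.
Proof.
rewrite /T3 exchange_big; apply: eq_bigr => j _; apply: eq_bigr => l _.
by apply: eq_bigr => m _; rewrite (addrC j) (mulrC (a _)).
Qed.

Lemma T3CA a b c : T3 a b c = T3 a c b.
Proof.
rewrite /T3; apply: eq_bigr => j _; rewrite exchange_big.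
apply: eq_bigr => l _; apply: eq_bigr => m _.
by rewrite (addrAC j); congr (_ * _); ring.
Qed.

(** Integration by parts: only pairs with [l = - j] contribute, and there the factors ['i * j] and
    ['i * l] are opposite. *)
Lemma B2_dx a b : B2 (cdx a) b = - B2 a (cdx b).
Proof.
apply/eqP; rewrite -addr_eq0 /B2 -big_split big1_seq// => j _ /=.
rewrite -big_split big1_seq// => l _ /=; rewrite /cdx.
have [jl|_] := eqVneq (j + l) 0; last by rewrite !mulr0 addr0.
have -> : l = - j by apply/eqP; rewrite -addr_eq0 addrC jl.
by rewrite mulrNz; ring.
Qed.

(** The derivative of a periodic product has mean zero: the three symbols add up to
    ['i * (j + l + m)], which vanishes on resonant triples. *)
Lemma T3_dx a b c : T3 (cdx a) b c + T3 a (cdx b) c + T3 a b (cdx c) = 0.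
Proof.
rewrite /T3 -!big_split big1_seq// => j _ /=.
rewrite -!big_split big1_seq// => l _ /=.
rewrite -!big_split big1_seq// => m _ /=; rewrite /cdx.
have [jl|_] := eqVneq (j + l + m) 0; last by rewrite !mulr0 !addr0.
have -> : m = - (j + l) by apply/eqP; rewrite -addr_eq0 addrC jl.
by rewrite mulrNz intrD; ring.
Qed.

(** The symbol is even, so it takes equal values at the paired frequencies [j] and [- j]. *)
Lemma B2_lap beta a b : B2 (clap beta a) b = B2 a (clap beta b).
Proof.
apply: eq_bigr => j _; apply: eq_bigr => l _; rewrite /clap.
have [jl|_] := eqVneq (j + l) 0; last by rewrite !mulr0.
have -> : l = - j by apply/eqP; rewrite -addr_eq0 addrC jl.
by rewrite normrN; ring.
Qed.

Lemma clap_dx beta a : clap beta (cdx a) = cdx (clap beta a).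
Proof. by apply/funext => k; rewrite /clap /cdx mulrCA. Qed.

Lemma clap_half beta a : beta != 0 ->
  clap (beta / 2) (clap (beta / 2) a) = clap beta a.
Proof.
move=> b0; apply/funext => k; rewrite /clap mulrA -rmorphM/= -powRD.
  by congr ((_ `^ _)%:C * _); lra.
by rewrite -splitr (negbTE b0).
Qed.

Lemma cdx_delta : cdx (fun k => (k == 0)%:R) = fun=> 0 :> R[i].
Proof.
apply/funext => k; rewrite /cdx.
by have [->|] := eqVneq k 0; rewrite ?mulr0// mul0r.
Qed.

(** The Laplacian kills constants. At frequency 0 this rests on the convention for [powR]: the power
    of 0 is 0 for a nonzero exponent, and 1 for exponent 0. *)
Lemma clap_delta beta : beta != 0 ->
  clap beta (fun k => (k == 0)%:R) = fun=> 0 :> R[i].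
Proof.
move=> b0; apply/funext => k; rewrite /clap.
by have [->|] := eqVneq k 0; rewrite ?mulr0// normr0 powR0// mul0r.
Qed.

Lemma cconjK : involutive cconj.
Proof. by move=> a; apply/funext => k; rewrite /cconj opprK conjcK. Qed.

Lemma cconj_dx a : cconj (cdx a) = cdx (cconj a).
Proof.
apply/funext => k; rewrite /cconj /cdx !conjcM.
have -> : conjc 'i%C = - 'i%C :> R[i] by simpc.
by rewrite mulrNz conjcN conjc_int mulrNN.
Qed.

Lemma cconj_lap beta a : cconj (clap beta a) = clap beta (cconj a).
Proof.
by apply/funext => k; rewrite /cconj /clap conjcM normrN conjc_real.
Qed.

Lemma conj_B2 a b : (B2 a b)^*%C = B2 (cconj a) (cconj b).
Proof.
rewrite /B2 -sum_modesN rmorph_sum; apply: eq_bigr => j _ /=.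
rewrite -sum_modesN rmorph_sum; apply: eq_bigr => l _ /=.
by rewrite !rmorphM/= rmorph_nat -opprD oppr_eq0.
Qed.

Lemma conj_T3 a b c : (T3 a b c)^*%C = T3 (cconj a) (cconj b) (cconj c).
Proof.
rewrite /T3 -sum_modesN rmorph_sum; apply: eq_bigr => j _ /=.
rewrite -sum_modesN rmorph_sum; apply: eq_bigr => l _ /=.
rewrite -sum_modesN rmorph_sum; apply: eq_bigr => m _ /=.
by rewrite !rmorphM/= rmorph_nat -!opprD oppr_eq0.
Qed.

Lemma B2Bl a b c : B2 (csub a b) c = B2 a c - B2 b c.
Proof.
rewrite /B2 -sumrB; apply: eq_bigr => j _; rewrite -sumrB.
by apply: eq_bigr => l _; rewrite /csub !mulrBl.
Qed.

Lemma T3Bl a b c d : T3 (csub a b) c d = T3 a c d - T3 b c d.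
Proof.
rewrite /T3 -sumrB; apply: eq_bigr => j _; rewrite -sumrB.
apply: eq_bigr => l _; rewrite -sumrB; apply: eq_bigr => m _.
by rewrite /csub !mulrBl.
Qed.

Lemma T3Br a b c d : T3 a (csub b c) d = T3 a b d - T3 a c d.
Proof. by rewrite T3C T3Bl T3C (T3C c). Qed.

Lemma cdxB a b : cdx (csub a b) = csub (cdx a) (cdx b).
Proof. by apply/funext => k; rewrite /cdx /csub mulrBr. Qed.

Lemma clapB beta a b : clap beta (csub a b) = csub (clap beta a) (clap beta b).
Proof. by apply/funext => k; rewrite /clap /csub mulrBr. Qed.

(** The delta at 0 is the coefficient sequence of the constant 1, so this pairing is the mean
    value. *)
Lemma B2_delta a : B2 a (fun k => (k == 0)%:R) = a 0.
Proof.
rewrite /B2 (bigD1_seq 0) ?mem_modes ?modes_uniq//=.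
rewrite (bigD1_seq 0) ?mem_modes ?modes_uniq//=.
rewrite !mulr1 !big1 ?addr0// => j j0; last by rewrite (negbTE j0) mulr0 mul0r.
rewrite big1// => l _.
by have [->|] := eqVneq l 0; rewrite ?mulr0 ?mul0r// addr0 (negbTE j0) mulr0.
Qed.

Lemma T3_delta a b : T3 a b (fun k => (k == 0)%:R) = B2 a b.
Proof.
apply: eq_bigr => j _; apply: eq_bigr => l _.
rewrite (bigD1_seq 0) ?mem_modes ?modes_uniq//= addr0 mulr1 big1 ?addr0//.
by move=> m m0; rewrite (negbTE m0) mulr0 mul0r.
Qed.

Lemma B2_0 a : B2 a (fun=> 0) = 0.
Proof. by apply: big1 => j _; apply: big1 => l _; rewrite mulr0 mul0r. Qed.

Lemma T3_0 a b : T3 a b (fun=> 0) = 0.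
Proof.
apply: big1 => j _; apply: big1 => l _; apply: big1 => m _.
by rewrite mulr0 mul0r.
Qed.

(** The Wiener (absolute sum) norm. Dropping the resonance condition bounds the mean of a product by
    the product of these norms. *)
Definition cnorm a : R[i] := \sum_(k <- modes N) `|a k|.

Lemma cnorm_ge0 a : 0 <= cnorm a.
Proof. by apply: sumr_ge0. Qed.

Lemma B2_le a b : `|B2 a b| <= cnorm a * cnorm b.
Proof.
rewrite (le_trans (ler_norm_sum _ _ _))// /cnorm mulr_suml ler_sum// => j _.
rewrite (le_trans (ler_norm_sum _ _ _))// mulr_sumr ler_sum// => l _.
by rewrite !normrM; case: eqP; rewrite ?normr1 ?mulr1// normr0 mulr0 mulr_ge0.
Qed.

Lemma T3_le a b c : `|T3 a b c| <= cnorm a * cnorm b * cnorm c.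
Proof.
rewrite (le_trans (ler_norm_sum _ _ _))// /cnorm -mulrA mulr_suml.
rewrite ler_sum// => j _.
rewrite mulr_suml mulr_sumr (le_trans (ler_norm_sum _ _ _))// ler_sum// => l _.
rewrite mulrA mulr_sumr (le_trans (ler_norm_sum _ _ _))// ler_sum// => m _.
by rewrite !normrM; case: eqP; rewrite ?normr1 ?mulr1// normr0 mulr0 !mulr_ge0.
Qed.

(** With finitely many modes every multiplier is bounded: each value of [f] is at most the sum of
    all of them. Derivatives and Laplacians thus cost only a constant depending on [N]. *)
Lemma cnorm_mult_le (f : int -> R[i]) a :
  cnorm (fun k => f k * a k) <= cnorm f * cnorm a.
Proof.
rewrite {1 3}/cnorm mulr_sumr big_seq [leRHS]big_seq ler_sum// => k kN.
rewrite normrM ler_wpM2r// /cnorm (bigD1_seq k) ?modes_uniq//=.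
by rewrite lerDl sumr_ge0.
Qed.

Lemma cnorm_conj a : cnorm (cconj a) = cnorm a.
Proof.
rewrite /cnorm -sum_modesN; apply: eq_bigr => k _.
by rewrite /cconj opprK normcJ.
Qed.

(** Parseval: resonance selects [l = - j], and [cconj] turns the bilinear pairing into the Hermitian
    one. *)
Lemma B2_conj a b : B2 a (cconj b) = \sum_(k <- modes N) a k * (b k)^*%C.
Proof.
apply: eq_big_seq => j jN; rewrite (bigD1_seq (- j)) ?modes_uniq//=; last first.
  by move: jN; rewrite !mem_modes abszN.
rewrite subrr eqxx mulr1 /cconj opprK big1 ?addr0// => l lj.
by rewrite addrC addr_eq0 (negbTE lj) mulr0.
Qed.

(** Cauchy-Schwarz against the constant sequence 1, obtained by expanding the square and applying
    the arithmetic-geometric mean inequality to each pair. *)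
Lemma cnorm_sqr_le a :
  cnorm a ^+ 2 <= (size (modes N))%:R * \sum_(k <- modes N) `|a k| ^+ 2.
Proof.
have sum_const (x : R[i]) : \sum_(l <- modes N) x = (size (modes N))%:R * x.
  by rewrite big_const_seq count_predT iter_addr_0 mulr_natl.
have H j l : `|a j| * `|a l| <= 2^-1 * (`|a j| ^+ 2 + `|a l| ^+ 2).
  rewrite -subr_ge0.
  have -> : 2^-1 * (`|a j| ^+ 2 + `|a l| ^+ 2) - `|a j| * `|a l| =
     2^-1 * (`|a j| - `|a l|) ^+ 2 by field.
  by rewrite mulr_ge0// real_exprn_even_ge0// rpredB ?normr_real.
rewrite expr2 {1}/cnorm mulr_suml.
have : \sum_(j <- modes N) `|a j| * cnorm a <=
    \sum_(j <- modes N) \sum_(l <- modes N) 2^-1 * (`|a j| ^+ 2 + `|a l| ^+ 2).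
  by apply: ler_sum => j _; rewrite mulr_sumr; apply: ler_sum.
move=> /le_trans; apply; rewrite le_eqVlt; apply/orP; left; apply/eqP.
set S := \sum_(k <- _) `|a k| ^+ 2.
set n := (size _)%:R in sum_const *.
transitivity (\sum_(j <- modes N) (2^-1 * n * `|a j| ^+ 2 + 2^-1 * S)).
  apply: eq_bigr => j _; rewrite -mulr_sumr big_split/= -/S mulrDr.
  by rewrite sum_const mulrA.
rewrite big_split/= -mulr_sumr -/S sum_const.
by field.
Qed.

End ResonantSums.

(** * Integrals of trigonometric polynomials *)

Section Integrals.
Variable R : realType.
Implicit Types (u v : R -> R[i]) (k : int).

Definition ccontinuous u : Prop :=
  continuous (fun x => complex.Re (u x)) /\
  continuous (fun x => complex.Im (u x)).

Lemma complex_eta (z : R[i]) : z = complex.Re z +i* complex.Im z.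
Proof. by case: z. Qed.

Lemma integrable_per (f : R -> R) : continuous f ->
  lebesgue_measure.-integrable (@I_per R) (EFin \o f).
Proof.
move=> cf; apply: continuous_compact_integrable; first exact: segment_compact.
exact: continuous_subspaceT.
Qed.

Lemma measurable_per : measurable (@I_per R).
Proof. exact: measurable_itv. Qed.

Lemma fine_measure_per : fine (lebesgue_measure (@I_per R)) = 2 * pi.
Proof.
rewrite /I_per lebesgue_measure_itv/= lte_fin gtrN ?pi_gt0//=.
by rewrite opprK -mulr2n mulr_natl.
Qed.

Lemma ccontinuousD u v : ccontinuous u -> ccontinuous v ->
  ccontinuous (fun x => u x + v x).
Proof.
move=> [ru iu] [rv iv]; split=> x.
- have -> : (fun x => complex.Re (u x + v x)) =
      (fun x => complex.Re (u x) + complex.Re (v x)).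
    by apply/funext => y; case: (u y) (v y) => [? ?] [].
  by apply: continuousD; [exact: ru|exact: rv].
- have -> : (fun x => complex.Im (u x + v x)) =
      (fun x => complex.Im (u x) + complex.Im (v x)).
    by apply/funext => y; case: (u y) (v y) => [? ?] [].
  by apply: continuousD; [exact: iu|exact: iv].
Qed.

Lemma ccontinuousZ (c : R[i]) u :
  ccontinuous u -> ccontinuous (fun x => c * u x).
Proof.
case: c => a b [ru iu]; split=> x.
- have -> : (fun x => complex.Re ((a +i* b) * u x)) =
      (fun x => a * complex.Re (u x) - b * complex.Im (u x)).
    by apply/funext => y; case: (u y).
  by apply: cvgB; apply: cvgM;
    [exact: cvg_cst|exact: ru|exact: cvg_cst|exact: iu].
- have -> : (fun x => complex.Im ((a +i* b) * u x)) =
      (fun x => a * complex.Im (u x) + b * complex.Re (u x)).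
    by apply/funext => y; case: (u y).
  by apply: cvgD; apply: cvgM;
    [exact: cvg_cst|exact: iu|exact: cvg_cst|exact: ru].
Qed.

Lemma cintegralD u v : ccontinuous u -> ccontinuous v ->
  cintegral (fun x => u x + v x) = cintegral u + cintegral v.
Proof.
move=> [ru iu] [rv iv]; rewrite /cintegral.
rewrite {3}/GRing.add/=; congr (_ +i* _).
- rewrite -RintegralD; [|exact: measurable_per|exact: integrable_per..].
  by apply: eq_Rintegral => x _; case: (u x) (v x) => [? ?] [].
- rewrite -RintegralD; [|exact: measurable_per|exact: integrable_per..].
  by apply: eq_Rintegral => x _; case: (u x) (v x) => [? ?] [].
Qed.

Lemma cintegralZ (c : R[i]) u : ccontinuous u ->
  cintegral (fun x => c * u x) = c * cintegral u.
Proof.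
case: c => a b [ru iu].
pose A := \int[lebesgue_measure]_(x in @I_per R) complex.Re (u x).
pose B := \int[lebesgue_measure]_(x in @I_per R) complex.Im (u x).
transitivity ((a * A - b * B) +i* (a * B + b * A)); last by [].
rewrite /cintegral /A /B.
have ig (r : R) (f : R -> R) : continuous f ->
    lebesgue_measure.-integrable (@I_per R) (EFin \o (fun x => r * f x)).
  move=> cf; apply: integrable_per => x.
  by apply: continuousM; [exact: cvg_cst|exact: cf].
rewrite -!RintegralZl; try exact: measurable_per; try exact: integrable_per.
rewrite -RintegralB; [|exact: measurable_per|exact: ig..].
rewrite -RintegralD; [|exact: measurable_per|exact: ig..].
by congr (_ +i* _); apply: eq_Rintegral => x _; case: (u x) => p q; simpc.
Qed.

Lemma ccontinuous_sum (I : Type) (s : seq I) (F : I -> R -> R[i]) :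
  (forall i, ccontinuous (F i)) -> ccontinuous (fun x => \sum_(i <- s) F i x).
Proof.
move=> cF; elim: s => [|i s IH].
  by split=> x; under eq_fun do rewrite big_nil; exact: cvg_cst.
by under eq_fun do rewrite big_cons; exact: ccontinuousD.
Qed.

Lemma cintegral_sum (I : Type) (s : seq I) (F : I -> R -> R[i]) :
  (forall i, ccontinuous (F i)) ->
  cintegral (fun x => \sum_(i <- s) F i x) = \sum_(i <- s) cintegral (F i).
Proof.
move=> cF; elim: s => [|i s IH].
  rewrite big_nil; under eq_fun do rewrite big_nil.
  by rewrite /cintegral /= Rintegral_cst ?mul0r//; exact: measurable_per.
under eq_fun do rewrite big_cons.
by rewrite big_cons -IH cintegralD//; exact: ccontinuous_sum.
Qed.

(* Both sides are 0 when [f] is not integrable. *)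
Lemma Rintegral_perN (f : R -> R) :
  \int[lebesgue_measure]_(x in @I_per R) (- f x) =
  - \int[lebesgue_measure]_(x in @I_per R) f x.
Proof.
rewrite /Rintegral integralE [in RHS]integralE.
have -> : (fun x => (- f x)%:E) = (\- (fun x => (f x)%:E))%E by [].
rewrite funeposN funenegN.
by case: integral => [?| |]; case: integral => [?| |] //=;
  rewrite ?opprB// oppr0.
Qed.

Lemma cintegral_conj u : cintegral (fun x => (u x)^*%C) = (cintegral u)^*%C.
Proof.
rewrite /cintegral /=; congr (_ +i* _).
  by apply: eq_Rintegral => x _; case: (u x).
by rewrite -Rintegral_perN; apply: eq_Rintegral => x _; case: (u x).
Qed.

Lemma expiD (a b : R) : expi (a + b) = expi a * expi b.
Proof. by rewrite /expi cosD sinD; simpc; congr (_ +i* _); rewrite addrC. Qed.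

Lemma expi_conj (a : R) : (expi a)^*%C = expi (- a).
Proof. by rewrite /expi cosN sinN. Qed.

Lemma emodeD k l (x : R) : emode (k + l) x = emode k x * emode l x.
Proof. by rewrite /emode intrD mulrDl expiD. Qed.

Lemma emode_conj k (x : R) : (emode k x)^*%C = emode (- k) x.
Proof. by rewrite /emode expi_conj mulrNz mulNr. Qed.

Lemma is_derive_mull (a x : R) : is_derive x (1 : R) ( *%R a) a.
Proof.
have := @is_deriveZ _ _ _ id a x (1 : R) 1 _.
by rewrite /GRing.scale/= mulr1; apply.
Qed.

Lemma is_derive_cos_lin (a x : R) :
  is_derive x (1 : R) (fun y => cos (a * y)) (- a * sin (a * x)).
Proof.
have := is_derive1_comp (is_derive_cos (a * x)) (is_derive_mull a x).
by rewrite mulrC mulrN -mulNr.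
Qed.

Lemma is_derive_sin_lin (a x : R) :
  is_derive x (1 : R) (fun y => sin (a * y)) (a * cos (a * x)).
Proof.
have := is_derive1_comp (is_derive_sin (a * x)) (is_derive_mull a x).
by rewrite mulrC.
Qed.

Lemma continuous_is_derive (f : R -> R) (g : R -> R) :
  (forall x, is_derive x (1 : R) f (g x)) -> continuous f.
Proof.
move=> fg x; apply/differentiable_continuous/derivable1_diffP.
by have [] := fg x.
Qed.

Lemma ccontinuous_emode k : ccontinuous (emode k).
Proof.
split; apply: continuous_is_derive => x /=.
  exact: is_derive_cos_lin.
exact: is_derive_sin_lin.
Qed.

Lemma Rintegral_per_derive (F f : R -> R) :
  (forall x, is_derive x (1 : R) F (f x)) -> continuous f ->
  \int[lebesgue_measure]_(x in @I_per R) f x = F pi - F (- pi).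
Proof.
move=> dF cf; have cF := continuous_is_derive dF.
rewrite /Rintegral /I_per (@continuous_FTC2 _ f F)//.
- by rewrite gtrN ?pi_gt0.
- exact: continuous_subspaceT.
- split; first by move=> x _; have [] := dF x.
  + by apply: cvg_at_right_filter; exact: cF.
  + by apply: cvg_at_left_filter; exact: cF.
- by move=> x _; rewrite derive1E; have [] := dF x.
Qed.

Lemma sin_natpi (n : nat) : sin (n%:R * pi : R) = 0.
Proof.
elim: n => [|n IH]; first by rewrite mul0r sin0.
by rewrite -natr1 mulrDl mul1r sinDpi IH oppr0.
Qed.

Lemma sin_intpi k : sin (k%:~R * pi : R) = 0.
Proof.
case: k => n; first exact: sin_natpi.
by rewrite NegzE mulrNz mulNr sinN sin_natpi oppr0.
Qed.

(** For [k != 0] the antiderivatives are a multiple of the sine, which vanishes at both ends, and a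
    multiple of the cosine, which is even. *)
Lemma cintegral_emode k :
  cintegral (emode k) = (2 * pi)%:C * (k == 0)%:R :> R[i].
Proof.
have [->|k0] := eqVneq k 0.
  rewrite /cintegral /emode /expi /=.
  rewrite (_ : (fun x : R => cos (0%:~R * x)) = fun=> 1); last first.
    by apply/funext => x; rewrite mul0r cos0.
  rewrite (_ : (fun x : R => sin (0%:~R * x)) = fun=> 0); last first.
    by apply/funext => x; rewrite mul0r sin0.
  rewrite !Rintegral_cst//; try exact: measurable_per.
  rewrite mul0r mul1r mulr1.
  by congr (_ +i* _); exact: fine_measure_per.
rewrite mulr0 /cintegral /emode /expi /=.
have kR : k%:~R != 0 :> R by rewrite intr_eq0.
have dc (x : R) : is_derive x (1 : R)
    (fun x => - k%:~R^-1 * cos (k%:~R * x)) (sin (k%:~R * x)).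
  have := @is_deriveZ _ _ _ _ (- k%:~R^-1) x (1 : R) _
    (is_derive_cos_lin k%:~R x).
  by rewrite /GRing.scale/= mulrA mulrNN mulVf// mul1r.
have ds (x : R) : is_derive x (1 : R)
    (fun x => k%:~R^-1 * sin (k%:~R * x)) (cos (k%:~R * x)).
  have := @is_deriveZ _ _ _ _ (k%:~R^-1) x (1 : R) _
    (is_derive_sin_lin k%:~R x).
  by rewrite /GRing.scale/= mulKf.
have [cc cs] := ccontinuous_emode k.
rewrite (Rintegral_per_derive ds cc) (Rintegral_per_derive dc cs).
by rewrite mulrN cosN sinN sin_intpi oppr0 !mulr0 !subrr.
Qed.

(** * Trigonometric polynomials and their coefficients *)

Section Trigonometric.
Variable N : nat.
Implicit Types (a b c q : int -> R[i]).

Definition tp a (x : R) : R[i] := \sum_(k <- modes N) a k * emode k x.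

Lemma tp_conj a x : (tp a x)^*%C = tp (cconj a) x.
Proof.
rewrite /tp -sum_modesN rmorph_sum; apply: eq_bigr => k _ /=.
change (conjc (a (- k) * emode (- k) x) = cconj a k * emode k x).
by rewrite conjcM emode_conj opprK.
Qed.

Lemma cintegral_tp a : cintegral (tp a) = (2 * pi)%:C * a 0.
Proof.
rewrite cintegral_sum => [|k]; last exact/ccontinuousZ/ccontinuous_emode.
rewrite (bigD1_seq 0) ?mem_modes ?modes_uniq//= big1 ?addr0 => [|k k0].
  rewrite cintegralZ ?cintegral_emode ?mulr1 1?mulrC//.
  exact: ccontinuous_emode.
rewrite cintegralZ ?cintegral_emode ?(negbTE k0) ?mulr0//.
exact: ccontinuous_emode.
Qed.

Lemma tpM_sum a b x : tp a x * tp b x =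
  \sum_(j <- modes N) \sum_(l <- modes N) (a j * b l) * emode (j + l) x.
Proof.
rewrite /tp mulr_suml; apply: eq_bigr => j _; rewrite mulr_sumr.
by apply: eq_bigr => l _; rewrite emodeD mulrACA.
Qed.

Lemma tpM3_sum a b c x : tp a x * tp b x * tp c x =
  \sum_(j <- modes N) \sum_(l <- modes N) \sum_(m <- modes N)
    (a j * b l * c m) * emode (j + l + m) x.
Proof.
rewrite tpM_sum mulr_suml; apply: eq_bigr => j _; rewrite mulr_suml.
apply: eq_bigr => l _; rewrite /tp mulr_sumr; apply: eq_bigr => m _.
by rewrite (emodeD (j + l)) mulrACA.
Qed.

Lemma ccontinuous_Zemode (c : R[i]) k : ccontinuous (fun x => c * emode k x).
Proof. exact/ccontinuousZ/ccontinuous_emode. Qed.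

Lemma cintegral_Zemode (c : R[i]) k :
  cintegral (fun x => c * emode k x) = (2 * pi)%:C * (c * (k == 0)%:R).
Proof.
by rewrite cintegralZ ?cintegral_emode 1?mulrCA//; exact: ccontinuous_emode.
Qed.

Lemma ccontinuous_tpM a b : ccontinuous (fun x => tp a x * tp b x).
Proof.
under eq_fun do rewrite tpM_sum.
apply: ccontinuous_sum => j; apply: ccontinuous_sum => l.
exact: ccontinuous_Zemode.
Qed.

Lemma ccontinuous_tpM3 a b c : ccontinuous (fun x => tp a x * tp b x * tp c x).
Proof.
under eq_fun do rewrite tpM3_sum.
apply: ccontinuous_sum => j; apply: ccontinuous_sum => l.
by apply: ccontinuous_sum => m; exact: ccontinuous_Zemode.
Qed.

Lemma cintegral_tpM a b :
  cintegral (fun x => tp a x * tp b x) = (2 * pi)%:C * B2 N a b.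
Proof.
under eq_fun do rewrite tpM_sum.
rewrite cintegral_sum => [|j]; last first.
  by apply: ccontinuous_sum => l; exact: ccontinuous_Zemode.
rewrite /B2 mulr_sumr; apply: eq_bigr => j _.
rewrite cintegral_sum => [|l]; last exact: ccontinuous_Zemode.
by rewrite mulr_sumr; apply: eq_bigr => l _; exact: cintegral_Zemode.
Qed.

Lemma cintegral_tpM3 a b c :
  cintegral (fun x => tp a x * tp b x * tp c x) = (2 * pi)%:C * T3 N a b c.
Proof.
under eq_fun do rewrite tpM3_sum.
rewrite cintegral_sum => [|j]; last first.
  apply: ccontinuous_sum => l; apply: ccontinuous_sum => m.
  exact: ccontinuous_Zemode.
rewrite /T3 mulr_sumr; apply: eq_bigr => j _.
rewrite cintegral_sum => [|l]; last first.
  by apply: ccontinuous_sum => m; exact: ccontinuous_Zemode.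
rewrite mulr_sumr; apply: eq_bigr => l _.
rewrite cintegral_sum => [|m]; last exact: ccontinuous_Zemode.
by rewrite mulr_sumr; apply: eq_bigr => m _; exact: cintegral_Zemode.
Qed.

Lemma twopi_neq0 : (2 * pi)%:C != 0 :> R[i].
Proof. by rewrite fmorph_eq0 mulf_neq0// gt_eqF// pi_gt0. Qed.

(** Multiplying by the conjugate mode shifts frequency [j] to [j - k], and integration keeps only
    [j = k], if that mode is present. *)
Lemma fourier_tp a k : fourier (tp a) k = a k *+ (k \in modes N).
Proof.
rewrite /fourier fmorphV.
transitivity (((2 * pi)%:C)^-1 *
    (\sum_(j <- modes N) (2 * pi)%:C * (a j * (j - k == 0)%:R))).
  congr (_ * _).
  transitivity (cintegral (fun x => \sum_(j <- modes N) a j * emode (j - k) x)).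
    congr cintegral; apply/funext => x; rewrite /tp mulr_suml.
    apply: eq_bigr => j _; rewrite -mulrA; congr (_ * _).
    by rewrite emodeD -emode_conj /emode expi_conj.
  rewrite cintegral_sum => [|j]; last exact: ccontinuous_Zemode.
  by apply: eq_bigr => j _; exact: cintegral_Zemode.
rewrite -mulr_sumr mulKf ?twopi_neq0//.
have [kN|kN] := boolP (k \in modes N).
  rewrite (bigD1_seq k) ?modes_uniq//= subrr eqxx mulr1 big1 ?addr0// => j jk.
  by rewrite subr_eq0 (negbTE jk) mulr0.
rewrite big1_seq// => j /= jN; rewrite subr_eq0.
by have [jk|_] := eqVneq j k; [rewrite -jk jN in kN|rewrite mulr0].
Qed.

Lemma fracLap_tp beta a x : fracLap beta (tp a) x = tp (clap beta a) x.
Proof.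
(* From index [N] on, the extra terms of the partial sum have zero coefficient, so the limit
   defining [fracLap] is that of an eventually constant sequence. *)
have H n : (N <= n)%N ->
    fracLap_sum beta (tp a) n x = tp (clap beta a) x.
  move=> Nn; rewrite /fracLap_sum /tp.
  transitivity (\sum_(k <- modes n | k \in modes N) clap beta a k * emode k x).
    rewrite [RHS]big_mkcond; apply: eq_bigr => k _; rewrite fourier_tp /clap.
    by case: ifP => _; rewrite // mulr0 mul0r.
  rewrite -big_filter; apply/perm_big/uniq_perm.
  - by rewrite filter_uniq// modes_uniq.
  - exact: modes_uniq.
  - move=> k; rewrite mem_filter !mem_modes.
    by case: leqP => //= kN; rewrite (leq_trans kN).
rewrite /fracLap [RHS]complex_eta.
by congr (_ +i* _); apply: (@lim_near_cst R) => //; exists N => // n /= /H ->.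
Qed.

(** The constant sequence [fun=> c] is a device to write the factor ['i * k * c] in terms of
    [cdx]. *)
Lemma is_derive_emode k x (c : R[i]) :
  is_derive x (1 : R) (fun y => complex.Re (c * emode k y))
    (complex.Re (cdx (fun=> c) k * emode k x)) /\
  is_derive x (1 : R) (fun y => complex.Im (c * emode k y))
    (complex.Im (cdx (fun=> c) k * emode k x)).
Proof.
case: c => p q; rewrite /cdx /emode /expi.
have dc := is_derive_cos_lin k%:~R x; have ds := is_derive_sin_lin k%:~R x.
have -> : (k%:~R : R[i]) = (k%:~R : R)%:C by rewrite rmorph_int.
split.
- have := is_deriveB (is_deriveZ p dc) (is_deriveZ q ds).
  rewrite /GRing.scale /=; simpc => H; apply: is_derive_eq => /=.
  by ring.
- have := is_deriveD (is_deriveZ p ds) (is_deriveZ q dc).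
  rewrite /GRing.scale /=; simpc => H; apply: is_derive_eq => /=.
  by ring.
Qed.

Lemma dx_tp a x : dx (tp a) x = tp (cdx a) x.
Proof.
rewrite [RHS]complex_eta /dx.
suff [hr hi] :
    is_derive x (1 : R) (fun y => complex.Re (tp a y))
      (complex.Re (tp (cdx a) x)) /\
    is_derive x (1 : R) (fun y => complex.Im (tp a y))
      (complex.Im (tp (cdx a) x)).
  by rewrite !derive1E; congr (_ +i* _); apply: derive_val.
rewrite /tp; elim: (modes N) => [|k s [IHr IHi]].
  by split; under eq_fun do rewrite big_nil; rewrite big_nil;
    apply: (is_derive_cst (0 : R)).
have [er ei] := is_derive_emode k x (a k).
by split; under eq_fun do rewrite big_cons raddfD;
  rewrite big_cons raddfD /=; apply: is_deriveD.
Qed.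

End Trigonometric.

End Integrals.

(** * Derivatives within a set *)

Section DerivativesWithin.
Variables (R : realType) (D : set R).
Implicit Types (f g : R -> R) (t l m : R).

Let dw_filter t : Filter (within D t^').
Proof. exact: within_filter. Qed.

Lemma has_derivative_within_eq f g t l : D t -> (forall s, D s -> f s = g s) ->
  has_derivative_within D f t l -> has_derivative_within D g t l.
Proof.
move=> Dt fg; rewrite /has_derivative_within => H.
apply: cvg_trans H; apply: near_eq_cvg; near=> s.
have Ds : D s by near: s; exact: withinT.
by rewrite !fg.
Unshelve. all: by end_near. Qed.

Lemma has_derivative_within_cst (c : R) t :
  has_derivative_within D (fun=> c) t 0.
Proof.
rewrite /has_derivative_within; under eq_fun do rewrite subrr mul0r.
exact: cvg_cst.
Qed.

Lemma has_derivative_withinD f g t l m :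
  has_derivative_within D f t l -> has_derivative_within D g t m ->
  has_derivative_within D (fun s => f s + g s) t (l + m).
Proof.
rewrite /has_derivative_within => hf hg.
under eq_fun do rewrite opprD addrACA mulrDl.
exact: cvgD.
Qed.

Lemma has_derivative_within_cvg f t l : has_derivative_within D f t l ->
  f s @[s --> within D t^'] --> f t.
Proof.
move=> hf.
have hid : s @[s --> within D t^'] --> t.
  by apply: cvg_within_filter; exact: nbhs_dnbhs.
(* Away from [t] this expression is [f s], and its limit is read off from that of the difference
   quotient. *)
have : f t + (s - t) * ((f s - f t) / (s - t)) @[s --> within D t^'] -->
    f t + (t - t) * l.
  apply: cvgD; first exact: cvg_cst.
  by apply: cvgM => //; apply: cvgB => //; exact: cvg_cst.
rewrite subrr mul0r addr0; apply: cvg_trans; apply: near_eq_cvg; near=> s.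
have st : s != t by near: s; apply: filterS (nbhs_dnbhs_neq t).
by rewrite mulrC divfK ?subr_eq0// addrC subrK.
Unshelve. all: by end_near. Qed.

Lemma has_derivative_withinM f g t l m :
  has_derivative_within D f t l -> has_derivative_within D g t m ->
  has_derivative_within D (fun s => f s * g s) t (l * g t + f t * m).
Proof.
move=> hf hg; have cg := has_derivative_within_cvg hg.
rewrite /has_derivative_within.
have -> : (fun s => (f s * g s - f t * g t) / (s - t)) =
    (fun s => (f s - f t) / (s - t) * g s + f t * ((g s - g t) / (s - t))).
  by apply/funext => s; ring.
by apply: cvgD; apply: cvgM => //; exact: cvg_cst.
Qed.

Lemma has_derivative_withinN f t l : has_derivative_within D f t l ->
  has_derivative_within D (fun s => - f s) t (- l).
Proof.
move=> hf; rewrite /has_derivative_within; under eq_fun do rewrite -opprD mulNr.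
exact: cvgN.
Qed.

Lemma has_derivative_within_continuous f t l : has_derivative_within D f t l ->
  f s @[s --> within D (nbhs t)] --> f t.
Proof.
move=> /has_derivative_within_cvg cf A fA.
have : nbhs t (fun s => s != t -> D s -> A (f s)) := cf _ fA.
apply: (@filterS _ _ _ _ (fun s => D s -> A (f s))) => s.
have [->|] := eqVneq s t; last by move=> st; apply.
by move=> _ _; exact: nbhs_singleton.
Qed.

(** At an interior point the restriction to [D] is eventually void, and the translation by [t]
    carries punctured neighbourhoods of 0 to those of [t]. This gives the ordinary derivatives that
    the monotonicity criterion asks for. *)
Lemma is_derive_within f t l : nbhs t D -> has_derivative_within D f t l ->
  is_derive t (1 : R) f l.
Proof.
move=> nD hf.
have shiftc : (h *: 1 + t) @[h --> (0 : R)^'] --> within D t^'.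
  move=> A; rewrite /within /= => nA.
  have {}nA : \forall s \near t^', A s.
    near=> s; have : D s -> A s by near: s.
    by apply; near: s; exact: nbhs_dnbhs.
  move: nA; rewrite /dnbhs /within/= => /nbhs_ballP[e /= e0 eA].
  rewrite nbhs_simpl /=; apply/nbhs_ballP; exists e => //= h.
  rewrite /ball/= sub0r normrN => he h0.
  have -> : h *: 1 = h by rewrite /GRing.scale/= mulr1.
  apply: eA; first by rewrite /ball/= opprD addrCA subrr addr0 normrN.
  by rewrite -subr_eq0 addrK.
have H : h^-1 *: (f (h *: 1 + t) - f t) @[h --> (0 : R)^'] --> l.
  have := cvg_comp _ _ shiftc hf.
  rewrite /comp; apply: cvg_trans; apply: near_eq_cvg; apply: nearW => h.
  by rewrite addrK /GRing.scale/= mulr1 mulrC.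
apply: DeriveDef; first by apply/cvg_ex; exists l.
exact: cvg_lim H.
Unshelve. all: by end_near. Qed.

End DerivativesWithin.

Section ComplexDerivativesWithin.
Variables (R : realType) (D : set R).
Implicit Types (f g : R -> R[i]) (t : R) (l m : R[i]).

Lemma has_cderivative_within_eq f g t l : D t -> (forall s, D s -> f s = g s) ->
  has_cderivative_within D f t l -> has_cderivative_within D g t l.
Proof.
move=> Dt fg [hr hi]; split.
  by apply: has_derivative_within_eq hr => // s Ds; rewrite fg.
by apply: has_derivative_within_eq hi => // s Ds; rewrite fg.
Qed.

Lemma has_cderivative_within_cst (c : R[i]) t :
  has_cderivative_within D (fun=> c) t 0.
Proof. by split; exact: has_derivative_within_cst. Qed.

Lemma has_cderivative_withinD f g t l m :
  has_cderivative_within D f t l -> has_cderivative_within D g t m ->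
  has_cderivative_within D (fun s => f s + g s) t (l + m).
Proof.
move=> [fr fi] [gr gi]; split; rewrite raddfD; under eq_fun do rewrite raddfD;
  exact: has_derivative_withinD.
Qed.

Lemma has_cderivative_withinM f g t l m :
  has_cderivative_within D f t l -> has_cderivative_within D g t m ->
  has_cderivative_within D (fun s => f s * g s) t (l * g t + f t * m).
Proof.
move=> [fr fi] [gr gi].
have eR (z w : R[i]) : complex.Re (z * w) =
    complex.Re z * complex.Re w + - (complex.Im z * complex.Im w).
  by case: z w => ? ? [].
have eI (z w : R[i]) : complex.Im (z * w) =
    complex.Re z * complex.Im w + complex.Im z * complex.Re w.
  by case: z w => ? ? [].
have eRD (z w : R[i]) : complex.Re (z + w) = complex.Re z + complex.Re w.
  exact: raddfD.
have eID (z w : R[i]) : complex.Im (z + w) = complex.Im z + complex.Im w.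
  exact: raddfD.
split; rewrite ?eRD ?eID ?eR ?eI.
- under eq_fun do rewrite eR.
  have := has_derivative_withinD (has_derivative_withinM fr gr)
    (has_derivative_withinN (has_derivative_withinM fi gi)).
  by congr has_derivative_within; ring.
- under eq_fun do rewrite eI.
  have := has_derivative_withinD (has_derivative_withinM fr gi)
    (has_derivative_withinM fi gr).
  by congr has_derivative_within; ring.
Qed.

Lemma has_cderivative_withinZ (c : R[i]) f t l :
  has_cderivative_within D f t l ->
  has_cderivative_within D (fun s => c * f s) t (c * l).
Proof.
move=> hf; have := has_cderivative_withinM (has_cderivative_within_cst c t) hf.
by rewrite mul0r add0r.
Qed.

Lemma has_cderivative_withinN f t l : has_cderivative_within D f t l ->
  has_cderivative_within D (fun s => - f s) t (- l).
Proof.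
move=> [fr fi]; split; rewrite raddfN; under eq_fun do rewrite raddfN;
  exact: has_derivative_withinN.
Qed.

Lemma has_cderivative_within_conj f t l : has_cderivative_within D f t l ->
  has_cderivative_within D (fun s => (f s)^*%C) t (l^*)%C.
Proof.
move=> [fr fi]; split.
  have -> : complex.Re (l^*)%C = complex.Re l by case: (l).
  have -> // : (fun s => complex.Re (f s)^*%C) = (fun s => complex.Re (f s)).
  by apply/funext => s; case: (f s).
have -> : complex.Im (l^*)%C = - complex.Im l by case: (l).
have -> : (fun s => complex.Im (f s)^*%C) = (fun s => - complex.Im (f s)).
  by apply/funext => s; case: (f s).
exact: has_derivative_withinN.
Qed.

Lemma has_cderivative_within_sum (I : Type) (s : seq I) (F : I -> R -> R[i])
    (L : I -> R[i]) t :
  (forall i, has_cderivative_within D (F i) t (L i)) ->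
  has_cderivative_within D (fun x => \sum_(i <- s) F i x) t (\sum_(i <- s) L i).
Proof.
move=> hF; elim: s => [|i s IH].
  rewrite big_nil; under eq_fun do rewrite big_nil.
  exact: has_cderivative_within_cst.
rewrite big_cons; under eq_fun do rewrite big_cons.
exact: has_cderivative_withinD.
Qed.

Lemma has_cderivative_within_B2 N (a b : R -> int -> R[i]) t
    (a' b' : int -> R[i]) :
  (forall k, has_cderivative_within D (a^~ k) t (a' k)) ->
  (forall k, has_cderivative_within D (b^~ k) t (b' k)) ->
  has_cderivative_within D (fun s => B2 N (a s) (b s)) t
    (B2 N a' (b t) + B2 N (a t) b').
Proof.
move=> ha hb; rewrite /B2 -big_split; apply: has_cderivative_within_sum => j /=.
rewrite -big_split; apply: has_cderivative_within_sum => l /=.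
rewrite -mulrDl mulrC; under eq_fun do rewrite mulrC.
exact/has_cderivative_withinZ/has_cderivative_withinM.
Qed.

(** Uniqueness of limits requires that [t] be an accumulation point of [D], hence the properness
    hypothesis. *)
Lemma cderive_withinE f t l : ProperFilter (within D t^') ->
  has_cderivative_within D f t l -> cderive_within D f t = l.
Proof.
move=> pD [fr fi]; rewrite /cderive_within /derive_within.
by rewrite (cvg_lim _ fr)// (cvg_lim _ fi)//; case: (l).
Qed.

Lemma cC1_within_has_cderivative f t : D t -> cC1_within D f ->
  has_cderivative_within D f t (cderive_within D f t).
Proof. by move=> Dt [[fr _] [fi _]]; split; [exact: fr|exact: fi]. Qed.

End ComplexDerivativesWithin.

(** * Calculus on the time interval and Gronwall's inequality *)

Section TimeInterval.
Variables (R : realType) (tau : \bar R).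
Local Notation D := (time_interval tau).

Lemma time_interval_right t : D t -> exists2 T, t < T & D T.
Proof.
rewrite /time_interval /= => -[t0]; case: tau => [r| |] // h.
  move: h; rewrite lte_fin => tr; exists ((t + r) / 2); first lra.
  by rewrite lte_fin; split; lra.
by exists (t + 1); [lra|split; [lra|exact: ltry]].
Qed.

Lemma time_interval_segment t s : D t -> 0 <= s -> s <= t -> D s.
Proof.
move=> [_ tT] s0 st; split=> //; apply: le_lt_trans tT.
by rewrite lee_fin.
Qed.

(** The interval is open on the right, so its points accumulate at [t] from the right, including at
    [t = 0]. *)
Lemma time_interval_proper t : D t -> ProperFilter (within D t^').
Proof.
move=> Dt; have [T tT DT] := time_interval_right Dt.
have H A : within D t^' A -> t^'+ A.
  rewrite /within /dnbhs /within /= => nA.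
  rewrite /at_right /within/=; near=> s => ts.
  have sT : s < T by near: s; exact: lt_nbhsl.
  have : s != t -> D s -> A s by near: s.
  apply; first by rewrite gt_eqF.
  apply: time_interval_segment DT _ _; last exact: ltW.
  by case: Dt => t0 _; rewrite (le_trans t0)// ltW.
split; last exact: within_filter.
by move=> /H; exact: (@filter_not_empty _ t^'+).
Unshelve. all: by end_near. Qed.

Lemma time_interval_interior t : D t -> 0 < t -> nbhs t D.
Proof.
move=> Dt t0; have [T tT DT] := time_interval_right Dt.
near=> s; apply: time_interval_segment DT _ _; apply: ltW; near: s.
  exact: lt_nbhsr.
exact: lt_nbhsl.
Unshelve. all: by end_near. Qed.

Lemma time_interval_continuous (f : R -> R) (f' : R -> R) T :
  D T -> (forall t, D t -> has_derivative_within D f t (f' t)) ->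
  {within `[0, T], continuous f}.
Proof.
move=> DT hf; apply/subspace_continuousP => t /=.
rewrite in_itv/= => /andP[t0 tT].
have Dt := time_interval_segment DT t0 tT.
have := has_derivative_within_continuous (hf t Dt).
apply: cvg_trans; apply: cvg_app; apply: within_subset => s /=.
by rewrite in_itv/= => /andP[s0 sT]; exact: time_interval_segment DT s0 sT.
Qed.

Lemma time_interval_bounded (f : R -> R) (f' : R -> R) T :
  D T -> (forall t, D t -> has_derivative_within D f t (f' t)) ->
  exists M, forall t, 0 <= t -> t <= T -> f t <= M.
Proof.
move=> DT hf; have cf := time_interval_continuous DT hf.
have [c _ fc] := EVT_max (proj1 DT) cf.
by exists (f c) => t t0 tT; apply: fc; rewrite in_itv/= t0.
Qed.

(* Gronwall: [E t * expR (- K * t)] is nonincreasing. *)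
Lemma time_interval_gronwall (E : R -> R) (E' : R -> R) K T :
  D T -> (forall t, D t -> has_derivative_within D E t (E' t)) ->
  (forall t, 0 <= t -> t <= T -> E' t <= K * E t) ->
  E 0 = 0 -> E T <= 0.
Proof.
move=> DT hE EK E0; have T0 := proj1 DT.
pose G t := E t * expR (- K * t).
pose G' t := E' t * expR (- K * t) + E t * (- K * expR (- K * t)).
have dexp t : is_derive t (1 : R) (fun s => expR (- K * s))
    (- K * expR (- K * t)).
  have := is_derive1_comp (is_derive_expR (- K * t)) (is_derive_mull (- K) t).
  by rewrite mulrC.
(* Two-sided derivatives are available for [0 < t] only; at 0 the monotonicity criterion is
   satisfied with continuity. *)
have dG t : 0 < t -> t <= T -> is_derive t (1 : R) G (G' t).
  move=> t0 tT; have Dt := time_interval_segment DT (ltW t0) tT.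
  have dE := is_derive_within (time_interval_interior Dt t0) (hE _ Dt).
  have := is_deriveM dE (dexp t); rewrite /G /G' /GRing.scale /=.
  move=> H; apply: is_derive_eq; rewrite addrC mulrC.
  by congr (_ + _); rewrite mulrC.
have cG : {within `[0, T], continuous G}.
  apply/subspace_continuousP => x x0T; apply: cvgM.
    exact: (subspace_continuousP _ _).1 (time_interval_continuous DT hE) x x0T.
  apply: cvg_within_filter.
  have ce : {for x, continuous (fun s => expR (- K * s))}.
    by apply/differentiable_continuous/derivable1_diffP; have [] := dexp x.
  exact: ce.
have : G T <= G 0.
  apply: (@ler0_derive1_nincr _ G 0 T) => //.
  - by move=> x; rewrite in_itv/= => /andP[x0 xT]; have [] := dG x x0 (ltW xT).
  - move=> x; rewrite in_itv/= => /andP[x0 xT]; rewrite derive1E.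
    have [_ ->] := dG x x0 (ltW xT).
    rewrite /G'.
    have -> : E' x * expR (- K * x) + E x * (- K * expR (- K * x)) =
      (E' x - K * E x) * expR (- K * x) by ring.
    by rewrite mulr_le0_ge0 ?expR_ge0// subr_le0 EK// ltW.
by rewrite /G E0 mul0r pmulr_lle0 ?expR_gt0.
Qed.

End TimeInterval.

(** * The Galerkin system *)

Section Flux.
Variables (R : realType) (N : nat) (alpha kappa1 kappa2 gamma : R).
Implicit Types (a b q w : int -> R[i]).

Local Notation Lap := (clap alpha).
Local Notation B := (B2 N).
Local Notation T := (T3 N).
Local Notation nm := (cnorm N).

(** The right-hand side of the scheme divided by [2 * pi], where [q] holds the coefficients of the
    conjugate of the test function. *)
Definition flux a q : R[i] :=
  kappa1%:C * B a (cdx q) + (3 / 2 * gamma)%:C * T a a (cdx q)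
  - kappa2%:C * (2 * T a (cdx a) (Lap q) + T a (Lap (cdx a)) q).

(** The parameters are real, and differentiation and the Laplacian commute with conjugation. Hence
    the conjugate of a solution satisfies the same system. *)
Lemma conj_flux a q : (flux a q)^*%C = flux (cconj a) (cconj q).
Proof.
have c2 : (2 : R[i])^*%C = 2 by exact: conjc_nat.
rewrite /flux !(c2, conjcN, conjcM, conjc_real, conjcD) !conj_B2 !conj_T3.
by rewrite !(cconj_lap, cconj_dx).
Qed.

Lemma B2_dx_self a : B a (cdx a) = 0.
Proof.
apply/eqP; have /eqP := B2_dx N a a.
by rewrite B2C -addr_eq0 -mulr2n mulrn_eq0.
Qed.

Lemma flux_self a : flux a a = 0.
Proof.
(* By symmetry the three terms of [T3_dx] coincide, so three times this number is 0. *)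
have T0 : T a a (cdx a) = 0.
  apply/eqP; have /eqP := T3_dx N a a a.
  by rewrite T3C (T3CA _ a (cdx a) a) -mulr2n -mulrSr mulrn_eq0.
(* Two of the three terms coincide; after commuting [Lap] and [cdx], their sum with the third is
   exactly the dispersive bracket. *)
have TL := T3_dx N a a (Lap a).
rewrite (T3C _ (cdx a)) in TL.
rewrite /flux B2_dx_self T0 !mulr0 add0r add0r.
by rewrite (T3CA _ a (Lap _)) clap_dx mulr_natl mulr2n TL mulr0 oppr0.
Qed.

Lemma flux_delta a : alpha != 0 -> flux a (fun k => (k == 0)%:R) = 0.
Proof.
move=> a0; rewrite /flux.
rewrite cdx_delta clap_delta// B2_0 !T3_0 T3_delta !mulr0 !add0r.
(* The only surviving term is zero because the composite of the symmetric [Lap] with the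
   antisymmetric [cdx] is antisymmetric. *)
have H : B a (Lap (cdx a)) = - B a (Lap (cdx a)).
  by rewrite {1}clap_dx -[LHS]opprK -B2_dx -B2_lap B2C.
have -> : B a (Lap (cdx a)) = 0; last by rewrite mulr0 oppr0.
by apply/eqP; move/eqP: H; rewrite -addr_eq0 -mulr2n mulrn_eq0.
Qed.

(** Telescoping in each quadratic term, so that every summand carries exactly one factor [w]. *)
Lemma fluxB a b q (w := csub a b) : flux a q - flux b q =
  kappa1%:C * B w (cdx q)
  + (3 / 2 * gamma)%:C * (T w a (cdx q) + T b w (cdx q))
  - kappa2%:C * (2 * (T w (cdx a) (Lap q) + T b (cdx w) (Lap q))
     + (T w (Lap (cdx a)) q + T b (Lap (cdx w)) q)).
Proof.
by rewrite /w !(cdxB, clapB, T3Bl, T3Br, B2Bl) /flux; ring.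
Qed.

Lemma flux_lipschitz (M : R[i]) : 0 <= M -> exists2 K : R, 0 <= K &
  forall a b (w := csub a b), nm a <= M -> nm b <= M ->
    `|flux a w - flux b w| <= K%:C * nm w ^+ 2.
Proof.
move=> M0.
pose P := nm (fun k => 'i%C * k%:~R : R[i]).
pose Q := nm (fun k => (`|k|%:~R `^ alpha)%:C : R[i]).
have P0 : 0 <= P by exact: cnorm_ge0.
have Q0 : 0 <= Q by exact: cnorm_ge0.
have nP a : nm (cdx a) <= P * nm a by exact: cnorm_mult_le.
have nQ a : nm (Lap a) <= Q * nm a by exact: cnorm_mult_le.
(* One summand per term of [fluxB] tested against [w]: two factors [nm w] are split off, a remaining
   factor [a] or [b] costs [M], a derivative [P] and a Laplacian [Q]. *)
pose K : R[i] := `|kappa1%:C| * P + `|(3 / 2 * gamma)%:C| * (M * P + M * P)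
  + `|kappa2%:C| * (2 * (P * M * Q + M * P * Q) + (Q * P * M + M * Q * P)).
have K0 : 0 <= K by rewrite /K !(addr_ge0, mulr_ge0)// ler0n.
exists (complex.Re K); first by move: K0; rewrite lecE => /andP[].
move=> a b w aM bM; rewrite RRe_real ?ger0_real// fluxB -/w.
have n0 a' : 0 <= nm a' by exact: cnorm_ge0.
have bound (x y z : int -> R[i]) (X Y Z : R[i]) :
    nm x <= X -> nm y <= Y -> nm z <= Z -> `|T x y z| <= X * Y * Z.
  move=> xX yY zZ; apply: le_trans (T3_le _ _ _ _) _.
  by apply: ler_pM => //; [exact: mulr_ge0 (n0 x) (n0 y)|exact: ler_pM].
have nPM : nm (cdx a) <= P * M by apply: le_trans (nP _) _; rewrite ler_wpM2l.
have nQPM : nm (Lap (cdx a)) <= Q * (P * M).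
  by apply: le_trans (nQ _) _; rewrite ler_wpM2l.
have nQP : nm (Lap (cdx w)) <= Q * (P * nm w).
  by apply: le_trans (nQ _) _; rewrite ler_wpM2l.
have -> : K * nm w ^+ 2 = `|kappa1%:C| * (nm w * (P * nm w))
  + `|(3 / 2 * gamma)%:C| *
    (nm w * M * (P * nm w) + M * nm w * (P * nm w))
  + `|kappa2%:C| *
    (2 * (nm w * (P * M) * (Q * nm w) + M * (P * nm w) * (Q * nm w))
     + (nm w * (Q * (P * M)) * nm w + M * (Q * (P * nm w)) * nm w)).
  by rewrite /K; ring.
rewrite (le_trans (ler_normB _ _))// lerD//.
  rewrite (le_trans (ler_normD _ _))// lerD// normrM ler_wpM2l//.
    by apply: le_trans (B2_le _ _ _) _; rewrite ler_wpM2l.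
  by rewrite (le_trans (ler_normD _ _))// lerD// bound.
rewrite normrM ler_wpM2l// (le_trans (ler_normD _ _))// lerD//; last first.
  by rewrite (le_trans (ler_normD _ _))// lerD// bound.
rewrite normrM ger0_norm ?ler0n// ler_wpM2l ?ler0n//.
by rewrite (le_trans (ler_normD _ _))// lerD// bound.
Qed.

(** Bilinear rather than Hermitian, so that its derivative is the left-hand side of the scheme
    tested with [a] itself, up to the factor 2. *)
Definition cenergy a : R[i] := B a a + B a (Lap a).

Lemma has_cderivative_within_energy (D : set R) (a : R -> int -> R[i])
    (a' : int -> R[i]) t :
  (forall k, has_cderivative_within D (a^~ k) t (a' k)) ->
  has_cderivative_within D (fun s => cenergy (a s)) t
    (2 * (B a' (a t) + B a' (Lap (a t)))).
Proof.
move=> ha.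
have hL k : has_cderivative_within D (fun s => Lap (a s) k) t (Lap a' k).
  exact: has_cderivative_withinZ.
have := has_cderivative_withinD (has_cderivative_within_B2 N ha ha)
  (has_cderivative_within_B2 N ha hL).
rewrite (B2C _ (a t) a') -(B2_lap _ _ (a t) a') (B2C _ (Lap (a t))).
by congr has_cderivative_within; ring.
Qed.

(* [w] has coefficients satisfying [cconj w = - w], since it belongs to a
   purely imaginary function; this turns [- B2 w w] into a sum of squares. *)
Lemma imaginary_energy_ge a (w := csub a (cconj a)) :
  \sum_(k <- modes N) `|w k| ^+ 2 <= - cenergy w.
Proof.
have cw : cconj w = csub (cconj a) a.
  by apply/funext => k; rewrite /cconj /w /csub conjcD conjcN
    /cconj opprK conjcK.
have BN b : - B b w = B b (cconj w).
  by rewrite cw /w (B2C _ b) (B2C _ b) !B2Bl opprB.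
have BLN b : - B b (Lap w) = B b (cconj (Lap w)).
  by rewrite cconj_lap cw /w !clapB (B2C _ b) (B2C _ b) !B2Bl opprB.
(* By Parseval both parts become sums of squared moduli; the part weighted by the symbol of the
   Laplacian is nonnegative and is dropped. *)
rewrite /cenergy opprD BN BLN !B2_conj -big_split/= ler_sum// => k _.
rewrite -sqr_normc lerDl /clap conjcM conjc_real mulrCA -sqr_normc.
by rewrite mulr_ge0 ?exprn_ge0// ler0c powR_ge0.
Qed.

End Flux.

(** * Reality and conservation laws along a solution *)

Section Solution.
Variables (R : realType) (alpha kappa1 kappa2 gamma : R) (N : nat).
Variables (u0 : R -> R[i]) (tau : \bar R) (u : R -> R -> R[i]).
Hypothesis u_sol : galerkin_solution alpha kappa1 kappa2 gamma N tau u0 u.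

Local Notation D := (time_interval tau).
Local Notation c s := (fourier (u s)).
Local Notation c' t := (fun k => cderive_within D (fun s => fourier (u s) k) t).
Local Notation Flux := (flux N alpha kappa1 kappa2 gamma).

Lemma VN_tp (v : R -> R[i]) : VN N v -> v = tp N (fourier v).
Proof.
move=> [a va]; have -> : v = tp N a by apply/funext.
apply/funext => x; apply: eq_big_seq => k kN.
by rewrite fourier_tp kN.
Qed.

Lemma solution_tp s : D s -> u s = tp N (c s).
Proof. by move=> /(galerkin_VN u_sol)/VN_tp. Qed.

Lemma solution_derivative t k : D t ->
  has_cderivative_within D (fun s => c s k) t (c' t k).
Proof.
move=> Dt; apply: cC1_within_has_cderivative => //.
exact: galerkin_C1 u_sol k.
Qed.

Lemma inner_tp (f : R -> R[i]) q :
  inner f (tp N (cconj q)) = cintegral (fun x => f x * tp N q x).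
Proof.
by congr cintegral; apply/funext => x; rewrite tp_conj cconjK.
Qed.

(** The test function is taken with coefficients [cconj q], so that the conjugation in [inner]
    cancels and all integrals become bilinear or trilinear forms. *)
Lemma solution_weak t q : D t ->
  B2 N (c' t) q + B2 N (c' t) (clap alpha q) = Flux (c t) q.
Proof.
move=> Dt; have pD := time_interval_proper Dt.
have VNq : VN N (tp N (cconj q)) by exists (cconj q).
have /= := galerkin_eq u_sol VNq Dt.
(* At fixed [x], [u] is a finite combination of its Fourier coefficients, so its time derivative is
   the same combination of theirs. *)
have -> : (fun x => cderive_within D (u ^~ x) t) = tp N (c' t).
  apply/funext => x; apply: cderive_withinE.
  apply: (@has_cderivative_within_eq _ _ (fun s => tp N (c s) x)) => // [s Ds|].
    by rewrite -solution_tp.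
  apply: has_cderivative_within_sum => k.
  under eq_fun do rewrite mulrC; rewrite mulrC.
  exact/has_cderivative_withinZ/solution_derivative.
have -> : fracLap alpha (tp N (cconj q)) = tp N (cconj (clap alpha q)).
  by apply/funext => x; rewrite fracLap_tp cconj_lap.
have -> : dx (tp N (cconj q)) = tp N (cconj (cdx q)).
  by apply/funext => x; rewrite dx_tp cconj_dx.
rewrite !inner_tp; move: (c t) (solution_tp Dt) => a ->.
have -> : dx (tp N a) = tp N (cdx a) by apply/funext => x; rewrite dx_tp.
have -> : fracLap alpha (tp N (cdx a)) = tp N (clap alpha (cdx a)).
  by apply/funext => x; rewrite fracLap_tp.
rewrite !cintegral_tpM !cintegral_tpM3.
have -> : cintegral (fun x =>
    nonlinearity kappa1 gamma (tp N a x) * tp N (cdx q) x) =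
    kappa1%:C * ((2 * pi)%:C * B2 N a (cdx q)) +
    (3 / 2 * gamma)%:C * ((2 * pi)%:C * T3 N a a (cdx q)).
  rewrite -cintegral_tpM -cintegral_tpM3.
  rewrite -cintegralZ; last exact: ccontinuous_tpM.
  rewrite -cintegralZ; last exact: ccontinuous_tpM3.
  rewrite -cintegralD; [|apply: ccontinuousZ..]; first last.
  - exact: ccontinuous_tpM3.
  - exact: ccontinuous_tpM.
  by congr cintegral; apply/funext => x; rewrite /nonlinearity; ring.
move=> H; apply: (mulfI (twopi_neq0 R)); rewrite mulrDr H /flux; ring.
Qed.

Lemma solution_mass t : alpha != 0 -> D t ->
  has_cderivative_within D (fun s => cintegral (u s)) t 0.
Proof.
move=> a0 Dt.
apply: (@has_cderivative_within_eq _ _ (fun s => (2 * pi)%:C * c s 0)) => //.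
  by move=> s Ds; rewrite [in RHS](solution_tp Ds) cintegral_tp.
have c0 : c' t 0 = 0.
  have := solution_weak (fun k => (k == 0)%:R) Dt.
  by rewrite flux_delta// B2_delta clap_delta// B2_0 addr0.
rewrite -(mulr0 (2 * pi)%:C) -c0.
exact/has_cderivative_withinZ/solution_derivative.
Qed.

Hypothesis u0_real : forall x, u0 x \is Num.real.

Lemma fourier_real k : cconj (fourier u0) k = fourier u0 k.
Proof.
rewrite /cconj /fourier conjcM conjc_real -cintegral_conj.
congr (_ * cintegral _); apply/funext => x; rewrite conjcM expi_conj.
congr (_ * expi _); last by rewrite mulrNz mulNr opprK.
by have /complex_realP[r ->] := u0_real x; rewrite conjc_real.
Qed.

(* Gronwall for the difference of the solution and its complex conjugate, which
   solves the same system with the same initial value. *)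
Lemma solution_real T : D T -> {in modes N, cconj (c T) =1 c T}.
Proof.
move=> DT; have [T0 _] := DT.
pose w s := csub (c s) (cconj (c s)).
pose w' t := csub (c' t) (cconj (c' t)).
have hw t k : D t -> has_cderivative_within D (w^~ k) t (w' t k).
  move=> Dt; apply: has_cderivative_withinD; first exact: solution_derivative.
  exact/has_cderivative_withinN/has_cderivative_within_conj/solution_derivative.
have hE t : D t -> has_derivative_within D
    (fun s => complex.Re (- cenergy N alpha (w s))) t
    (complex.Re (- (2 * (B2 N (w' t) (w t) + B2 N (w' t) (clap alpha (w t)))))).
  move=> Dt.
  by have [] := has_cderivative_withinN
    (has_cderivative_within_energy N alpha (fun k => hw t k Dt)).
(* The sum of squared moduli is continuous in time, hence bounded on the compact interval up to [T].
   Cauchy-Schwarz and [x <= 1 + x ^+ 2] pass to [cnorm] without a square root; the maximum with 0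
   keeps the witness nonnegative. *)
have [M [M0 hM]] : exists M : R[i], 0 <= M /\
    forall t, 0 <= t -> t <= T -> cnorm N (c t) <= M.
  have hS t : D t -> has_derivative_within D
      (fun s => complex.Re (B2 N (c s) (cconj (c s)))) t
      (complex.Re (B2 N (c' t) (cconj (c t)) + B2 N (c t) (cconj (c' t)))).
    move=> Dt; apply: proj1.
    apply: (@has_cderivative_within_B2 _ D N (fun s => c s)
      (fun s => cconj (c s))) => k.
      exact: solution_derivative.
    exact/has_cderivative_within_conj/solution_derivative.
  have [M0 hM0] := time_interval_bounded DT hS.
  exists (1 + (size (modes N))%:R * (Num.max 0 M0)%:C); split.
    by rewrite addr_ge0// mulr_ge0 ?ler0n// ler0c le_max lexx.
  move=> t t0 tT; set x := cnorm N _.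
  have xx : x <= 1 + x ^+ 2.
    have xr : x \is Num.real by rewrite ger0_real// cnorm_ge0.
    rewrite -subr_ge0.
    have -> : 1 + x ^+ 2 - x = (x - 1 / 2) ^+ 2 + 3 / 4 by field.
    rewrite addr_ge0 ?divr_ge0 ?ler0n// real_exprn_even_ge0// rpredB//.
    by rewrite ger0_real// divr_ge0 ?ler0n.
  apply: (le_trans xx); rewrite lerD2l; apply: le_trans (cnorm_sqr_le _ _) _.
  rewrite ler_wpM2l ?ler0n//.
  have -> : \sum_(k <- modes N) `|c t k| ^+ 2 = B2 N (c t) (cconj (c t)).
    by rewrite B2_conj; apply: eq_bigr => k _; rewrite sqr_normc.
  have /RRe_real <- : B2 N (c t) (cconj (c t)) \is Num.real.
    rewrite B2_conj; apply: rpred_sum => k _.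
    by rewrite -sqr_normc rpredX// normr_real.
  by rewrite lecR le_max hM0 ?orbT.
have [K K0 hK] := flux_lipschitz N alpha kappa1 kappa2 gamma M0.
(* The opposite of this energy dominates a sum of squares, so it is a nonnegative real, and taking
   real parts for Gronwall loses nothing. *)
have real_energy t : cenergy N alpha (w t) =
    - (complex.Re (- cenergy N alpha (w t)))%:C.
  rewrite RRe_real ?opprK// ger0_real//.
  apply: le_trans (imaginary_energy_ge _ _ _).
  by apply: sumr_ge0 => k _; rewrite exprn_ge0.
have w_le t : cnorm N (w t) ^+ 2 <=
    (size (modes N))%:R * (complex.Re (- cenergy N alpha (w t)))%:C.
  apply: le_trans (cnorm_sqr_le _ _) _; rewrite ler_wpM2l ?ler0n//.
  by rewrite -[leRHS]opprK -real_energy imaginary_energy_ge.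
have hG : complex.Re (- cenergy N alpha (w T)) <= 0.
  (* The factor 2 comes from differentiating a quadratic form, [K] from the Lipschitz bound, and the
     number of modes from [w_le]. *)
  apply: (time_interval_gronwall (K := 2 * K * (size (modes N))%:R) DT hE).
    move=> t t0 tT; have Dt := time_interval_segment DT t0 tT.
    have -> : B2 N (w' t) (w t) + B2 N (w' t) (clap alpha (w t)) =
        Flux (c t) (w t) - Flux (cconj (c t)) (w t).
      (* The flux at the conjugate coefficients is the conjugate of the weak equation tested with
         [cconj (w t)]. *)
      rewrite -[in X in _ - X](cconjK (w t)) -conj_flux -!solution_weak//.
      by rewrite conjcD !conj_B2 cconj_lap !cconjK /w' !B2Bl; ring.
    have := hK (c t) (cconj (c t)) (hM t t0 tT).
    rewrite cnorm_conj => /(_ (hM t t0 tT)); rewrite -/(w t).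
    set d := _ - _ => dle.
    rewrite -lecR; apply: (@le_trans _ _ `|- (2 * d)|).
      apply: le_trans (normc_ge_Re _); rewrite lecR; exact: ler_norm.
    rewrite normrN normrM ger0_norm ?ler0n// !rmorphM/= -!mulrA rmorph_nat.
    rewrite ler_wpM2l ?ler0n//; apply: (le_trans dle).
    by rewrite ler_wpM2l ?ler0c// rmorph_nat w_le.
  (* The initial coefficients are those of [u0] cut off at [N]. The cutoff is even in [k], so it
     preserves the symmetry expressing that [u0] is real. *)
  have -> : w 0 = fun=> 0.
    apply/funext => k; rewrite /w /csub /cconj.
    have -> : u 0 = tp N (fourier u0) by exact: galerkin_init u_sol.
    rewrite !fourier_tp -fourier_real !mem_modes abszN.
    by case: leqP => _; rewrite ?mulr1n ?mulr0n /cconj ?conjc0 subrr.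
  by rewrite /cenergy B2_0 (B2C _ (fun=> 0)) B2_0 addr0 oppr0.
have nw : cnorm N (w T) = 0.
  apply/eqP; rewrite -sqrf_eq0 eq_le exprn_ge0 ?cnorm_ge0// andbT.
  apply: (le_trans (w_le T)); rewrite mulr_ge0_le0 ?ler0n//.
  by rewrite lecR.
move=> k kN; move: nw => /eqP; rewrite /cnorm psumr_eq0// => /allP/(_ k kN) /=.
by rewrite normr_eq0 /w /csub subr_eq0 => /eqP ->.
Qed.

(** Since the solution is real, the squared modulus is a plain square, and moving half of the
    Laplacian across identifies the integral with [2 * pi] times [cenergy]. Its derivative is a
    multiple of the flux tested with the solution itself, which is zero. *)
Lemma solution_energy t : alpha != 0 -> D t ->
  has_cderivative_within D
    (fun s => cintegral (fun x =>
       u s x ^+ 2 + `|fracLap (alpha / 2) (u s) x| ^+ 2)) t 0.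
Proof.
move=> a0 Dt.
apply: (@has_cderivative_within_eq _ _
  (fun s => (2 * pi)%:C * cenergy N alpha (c s))) => //.
  move=> s Ds; have cr := solution_real Ds.
  move: (fourier (u s)) (solution_tp Ds) cr => a -> cr.
  transitivity (cintegral (fun x => tp N a x * tp N a x +
     tp N (clap (alpha / 2) a) x * tp N (clap (alpha / 2) a) x)).
    rewrite cintegralD; [|exact: ccontinuous_tpM..].
    by rewrite !cintegral_tpM B2_lap clap_half// -mulrDr.
  congr cintegral; apply/funext => x; rewrite -expr2; congr (_ + _).
  rewrite fracLap_tp sqr_normc tp_conj cconj_lap; congr (_ * _).
  by apply: eq_big_seq => k kN; rewrite /clap cr.
have := has_cderivative_withinZ (2 * pi)%:C
  (has_cderivative_within_energy N alpha (fun k => solution_derivative k Dt)).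
by rewrite solution_weak// flux_self !mulr0.
Qed.

End Solution.

Theorem theorem3p1 (R : realType) (alpha kappa1 kappa2 gamma : R) (N : nat)
    (u0 : R -> R[i]) (tau : \bar R) (u : R -> R -> R[i])
    (alpha_range : 1 <= alpha <= 2) (gamma_gt0 : 0 < gamma)
    (u0_L2 : L2per u0) (u0_real : forall x, u0 x \is Num.real)
    (tau_gt0 : (0 < tau)%E)
    (u_sol : galerkin_solution alpha kappa1 kappa2 gamma N tau u0 u) :
  forall t, time_interval tau t ->
    has_cderivative_within (time_interval tau)
      (fun s => cintegral (u s)) t 0 /\
    has_cderivative_within (time_interval tau)
      (fun s => cintegral (fun x =>
         u s x ^+ 2 + `|fracLap (alpha / 2) (u s) x| ^+ 2)) t 0.
Proof.
have a0 : alpha != 0.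
  by case/andP: alpha_range => a1 _; rewrite gt_eqF// (lt_le_trans ltr01).
move=> t Dt; split; first exact: (solution_mass u_sol a0 Dt).
exact: (solution_energy u_sol u0_real a0 Dt).
Qed.
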